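(* Let $(X = \{x_1,\dots,x_n\}, d)$ with $n > 1$ (and $|X| = n$) be a finite quasihypermetric space and let $Y \subseteq X$ be a maximal strictly quasihypermetric subspace of $X$. Let $D = \bigl(d(x_i,x_j)\bigr)_{i,j=1}^n$ be the distance matrix of $X$ and let $r$ be the rank of $D$. Then \[ |Y| = \begin{cases} r, & \text{if } M(X) < \infty,\\ r-1, & \text{if } M(X) = \infty. \end{cases} \]
   Context: For a compact (in particular finite) metric space $(X,d)$, $\mathcal{M}(X)$ is the space of finite signed Borel measures on $X$; $\mathcal{M}_0(X)$ and $\mathcal{M}_1(X)$ are the subsets of measures of total mass $0$ and $1$, respectively. For $\mu \in \mathcal{M}(X)$ put $I(\mu) = \int_X\int_X d(x,y)\,d\mu(x)\,d\mu(y)$, and let $M(X) = \sup\{I(\mu) : \mu \in \mathcal{M}_1(X)\}$ (possibly $\infty$). $X$ is quasihypermetric if $I(\mu) \le 0$ for all $\mu \in \mathcal{M}_0(X)$, and strictly quasihypermetric if in addition, for $\mu \in \mathcal{M}_0(X)$, $I(\mu) = 0$ only when $\mu = 0$. A non-empty subspace $Y$ of a quasihypermetric space $X$ (with the restricted metric) is a maximal strictly quasihypermetric subspace of $X$ if $Y$ is compact and strictly quasihypermetric and no compact strictly quasihypermetric subspace of $X$ properly contains $Y$. *)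

(* Defs.v *)
From HB Require Import structures.
From mathcomp Require Import all_boot all_order all_algebra finmap.
From mathcomp Require Import all_classical all_reals all_analysis.

Set Implicit Arguments.
Unset Strict Implicit.
Unset Printing Implicit Defensive.

Import Order.TTheory GRing.Theory Num.Theory.
Import numFieldNormedType.Exports.

Local Open Scope classical_set_scope.
Local Open Scope ring_scope.

(* Library measurable spaces are pointed, so non-empty metric spaces are
   carried with a base point; no notion below depends on its choice. *)
#[short(type="pointedMetricType")]
HB.structure Definition PointedMetric (R : numDomainType) :=
  { T of Pointed T & Metric R T }.

Section signed_integral.
Context d (T : measurableType d) (R : realType).
Variable mu : {charge set T -> \bar R}.

Definition hahn_pos : set T := sval (cid (Hahn_decomposition mu)).

Definition hahn_neg : set T := sval (cid (svalP (cid (Hahn_decomposition mu)))).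

Lemma hahn_posneg : hahn_decomposition mu hahn_pos hahn_neg.
Proof. exact: (svalP (cid (svalP (cid (Hahn_decomposition mu))))). Qed.

(* The integral against the signed measure mu = mu^+ - mu^- (Jordan
   decomposition); it is independent of the chosen Hahn decomposition. *)
Definition signed_integral (f : T -> R) : R :=
  \int[jordan_pos hahn_posneg]_x f x - \int[jordan_neg hahn_posneg]_x f x.

End signed_integral.

Definition borel (R : realType) (X : pointedMetricType R) :=
  g_sigma_algebraType (@open X).

(* {charge _ -> _} takes finite values on measurable sets, and has arbitrary
   values on the other sets. *)
Definition signed_measure (R : realType) (X : pointedMetricType R) :=
  {charge set (borel X) -> \bar R}.

Section quasihypermetric.
Context (R : realType) (X : pointedMetricType R).

Definition mass0 : set (signed_measure X) := [set mu | mu setT = 0%E].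

Definition mass1 : set (signed_measure X) := [set mu | mu setT = 1%E].

Definition energy (mu : signed_measure X) : R :=
  signed_integral mu (fun y : borel X =>
    signed_integral mu (fun x : borel X => mdist (x : X) (y : X))).

Definition max_energy : \bar R := ereal_sup [set (energy mu)%:E | mu in mass1].

Definition quasihypermetric :=
  forall mu : signed_measure X, mass0 mu -> energy mu <= 0.

Definition strictly_quasihypermetric :=
  quasihypermetric /\
  forall mu : signed_measure X, mass0 mu -> energy mu = 0 ->
    forall A : set (borel X), measurable A -> mu A = 0%E.

End quasihypermetric.

Section subspace_metric.
Context (R : realType) (X : metricType R) (Y : set X).

Let dist (a b : Y) : R := mdist (set_val a) (set_val b).

Let dist_ge0 a b : 0 <= dist a b. Proof. exact: mdist_ge0. Qed.

Let dist_positivity a b : dist a b = 0 -> a = b.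
Proof. by move=> /mdist_positivity; exact: val_inj. Qed.

Let ballEdist (a : Y) e : ball a e = [set b | dist a b < e].
Proof.
have -> : ball a e = set_val @^-1` ball (set_val a) e by [].
by rewrite ballEmdist.
Qed.

HB.instance Definition _ := @PseudoMetric_isMetric.Build R (set_type Y)
  dist dist_ge0 dist_positivity ballEdist.

End subspace_metric.

Definition subspace_at (R : realType) (X : metricType R) (Y : set X) (y : Y)
  : Type := set_type Y.

HB.instance Definition _ (R : realType) (X : metricType R) (Y : set X) (y : Y)
  := Metric.copy (subspace_at y) (set_type Y).

HB.instance Definition _ (R : realType) (X : metricType R) (Y : set X) (y : Y)
  := isPointed.Build (subspace_at y) y.

(* The existence of the base point y makes Y non-empty. *)
Definition strictly_quasihypermetric_subspace (R : realType)
    (X : metricType R) (Y : set X) :=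
  exists y : Y, strictly_quasihypermetric (subspace_at y).

Definition maximal_strictly_quasihypermetric (R : realType)
    (X : metricType R) (Y : set X) :=
  [/\ Y !=set0, compact Y, strictly_quasihypermetric_subspace Y &
    ~ exists Z : set X, [/\ compact Z, strictly_quasihypermetric_subspace Z &
                            Y `<` Z]].

Definition distance_matrix (R : realType) (X : metricType R) (n : nat)
    (x : 'I_n -> X) : 'M[R]_n := \matrix_(i, j) mdist (x i) (x j).

(* Main.v *)
Require Import Defs.
From HB Require Import structures.
From mathcomp Require Import all_boot all_order all_algebra finmap.
From mathcomp Require Import all_classical all_reals all_analysis.
From mathcomp Require Import ring lra zify.

(**
A signed measure on a finite metric space is a row vector [v] with
[I(v) = v D v^T].  On the hyperplane of total mass [0] this form is negative
semidefinite, so its isotropic vectors form a subspace [K], namely the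
[v] of mass [0] for which [v D] is constant.  A set of points [A] is strict iff
[K] meets the coordinate space [R^A] trivially, and maximality then forces
[R^n = R^A + K]; hence [|A| = n - dim K].

Since [n > 1], vectors of [ker D] have mass [0], so by symmetry of [D]
there is [v] with [v D = (1, ..., 1)].  If [v] has nonzero mass, then
[K = ker D] and the normalisation of [v] maximises the energy over mass [1].
If [v] has mass [0], then [K = ker D + <v>] has one more dimension, and the
energy of [e_i + t v] is [2 t], so that [M(X)] is infinite.
*)

Set Implicit Arguments.
Unset Strict Implicit.
Unset Printing Implicit Defensive.

Import Order.TTheory GRing.Theory Num.Theory.

Local Open Scope classical_set_scope.
Local Open Scope ring_scope.

(** * Linear algebra of a symmetric form that is negative semidefinite on vectors of mass zero *)

Section negative_type.
Context (F : realFieldType) (n : nat) (D : 'M[F]_n).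
Implicit Types (u v w : 'rV[F]_n) (A B : {set 'I_n}).

Definition form u v : F := (u *m D *m v^T) 0 0.

Definition total v : F := \sum_i v 0 i.

Definition supported A v := forall i, i \notin A -> v 0 i = 0.

Definition isotropic v := total v = 0 /\ form v v = 0.

Definition strict A := forall v, supported A v -> isotropic v -> v = 0.

Lemma formE u v : form u v = \sum_i \sum_j u 0 j * v 0 i * D j i.
Proof.
rewrite /form mxE; apply: eq_bigr => i _; rewrite !mxE mulr_suml.
by apply: eq_bigr => j _; rewrite mulrAC.
Qed.

Lemma formDl u v w : form (u + v) w = form u w + form v w.
Proof. by rewrite /form !mulmxDl mxE. Qed.

Lemma formZl a u v : form (a *: u) v = a * form u v.
Proof. by rewrite /form -!scalemxAl mxE. Qed.

Lemma totalD u v : total (u + v) = total u + total v.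
Proof. by rewrite /total -big_split; apply: eq_bigr => i _; rewrite mxE. Qed.

Lemma totalZ a u : total (a *: u) = a * total u.
Proof. by rewrite /total mulr_sumr; apply: eq_bigr => i _; rewrite mxE. Qed.

Lemma totalB u v : total (u - v) = total u - total v.
Proof. by rewrite totalD -scaleN1r totalZ mulN1r. Qed.

Lemma total_delta i : total (delta_mx 0 i) = 1.
Proof.
rewrite /total (bigD1 i)//= big1 ?addr0 ?mxE ?eqxx// => j /negPf ji.
by rewrite mxE ji.
Qed.

Lemma form_delta u i : form u (delta_mx 0 i) = (u *m D) 0 i.
Proof. by rewrite /form trmx_delta -colE mxE. Qed.

Lemma form_const u v c : u *m D = const_mx c -> form u v = c * total v.
Proof.
move=> uD; rewrite /form uD mxE mulr_sumr.
by apply: eq_bigr => i _; rewrite !mxE.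
Qed.

Hypothesis Dsym : D^T = D.

Lemma formC u v : form u v = form v u.
Proof.
have -> : form u v = (u *m D *m v^T)^T 0 0 by rewrite [RHS]mxE.
by rewrite /form !trmx_mul trmxK Dsym mulmxA.
Qed.

Lemma formDr u v w : form u (v + w) = form u v + form u w.
Proof. by rewrite formC formDl !(formC u). Qed.

Lemma formZr a u v : form u (a *: v) = a * form u v.
Proof. by rewrite formC formZl formC. Qed.

Lemma form_diagD u v :
  form (u + v) (u + v) = form u u + 2 * form u v + form v v.
Proof. rewrite !formDl !formDr (formC v u); ring. Qed.

Lemma form_deltaDZ i v t : D i i = 0 -> v *m D = const_mx 1 -> total v = 0 ->
  form (delta_mx 0 i + t *: v) (delta_mx 0 i + t *: v) = 2 * t.
Proof.
move=> Dii vD v0; rewrite form_diagD formC !formZl form_delta -rowE !formZr.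
rewrite 2!(form_const _ vD) v0 total_delta !mxE Dii; ring.
Qed.

(** Write [w] as [v1 + (w - v1)]. Since [v1 *m D] is constant and [w - v1] has mass 0, the cross
    term vanishes, and the square of [w - v1] is nonpositive. *)
Lemma form_le_normalized v w : (forall u, total u = 0 -> form u u <= 0) ->
  v *m D = const_mx 1 -> total v != 0 -> total w = 1 ->
  form w w <= form ((total v)^-1 *: v) ((total v)^-1 *: v).
Proof.
move=> nsd vD v0 w1; set v1 := _ *: v.
have v11 : total v1 = 1 by rewrite totalZ mulVf.
rewrite -{1 2}(subrK v1 w) addrC form_diagD [form v1 (_ - _)]formZl.
rewrite (form_const _ vD) totalB v11 w1 subrr !mulr0 addr0 gerDl.
by apply: nsd; rewrite totalB w1 v11 subrr.
Qed.

Hypothesis D0 : forall i, D i i = 0.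
Hypothesis Dneq0 : forall i j, i != j -> D i j != 0.
Hypothesis n_gt1 : (1 < n)%N.
Hypothesis nsd : forall v, total v = 0 -> form v v <= 0.

(** The equality case of Cauchy-Schwarz: along the line [w + t *: v] the form is affine in [t] with
    slope [2 * form v w], and it can stay nonpositive only if that slope is 0. *)
Lemma isotropic_orthogonal v w : isotropic v -> total w = 0 -> form v w = 0.
Proof.
move=> [v0 vv0] w0; apply/eqP; apply: contraT => vw.
have H t : form w w + 2 * t * form v w <= 0.
  have := @nsd (w + t *: v); rewrite totalD totalZ v0 w0 mulr0 addr0.
  move=> /(_ erefl); rewrite form_diagD !formZl !formZr vv0 (formC w v).
  by rewrite !mulr0 addr0 mulrA.
(* This is the [t] at which the affine function takes the value 1. *)
have := H ((1 - form w w) / (2 * form v w)).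
have -> : 2 * ((1 - form w w) / (2 * form v w)) * form v w = 1 - form w w.
  by field.
lra.
Qed.

(** Orthogonality to the differences of two unit vectors says exactly that any two entries of
    [v *m D] agree. *)
Lemma isotropicP v :
  isotropic v <-> total v = 0 /\ exists c, v *m D = const_mx c.
Proof.
split=> [iv|[v0 [c vD]]]; last by split; rewrite // (form_const _ vD) v0 mulr0.
split; first by case: iv.
pose i0 := Ordinal (ltnW n_gt1); exists ((v *m D) 0 i0).
apply/rowP => i; rewrite [RHS]mxE; apply/eqP; rewrite -subr_eq0.
have := isotropic_orthogonal (w := delta_mx 0 i - delta_mx 0 i0) iv.
rewrite totalB !total_delta subrr => /(_ erefl).
by rewrite formDr -scaleN1r formZr !form_delta mulN1r => ->.
Qed.

(** Otherwise a unit vector minus the normalised [v] has mass 0 and is isotropic, while its image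
    under [D] is a row of [D]. That row would be constant, yet it is 0 on the diagonal and nonzero
    elsewhere. *)
Lemma kernel_total v : v *m D = 0 -> total v = 0.
Proof.
move=> vD; apply/eqP; apply: contraT => v0.
pose i0 := Ordinal (ltnW n_gt1); pose i1 := Ordinal n_gt1.
pose w := delta_mx 0 i0 - (total v)^-1 *: v.
have wD : w *m D = row i0 D.
  by rewrite mulmxBl -rowE -scalemxAl vD scaler0 subr0.
have tw : total w = 0 by rewrite totalB totalZ mulVf// total_delta subrr.
have /isotropicP[_ [c]] : isotropic w.
  split=> //; rewrite formDr form_delta wD -scaleNr formZr formC.
  by rewrite (form_const (c := 0) _) ?vD// !mxE D0; ring.
rewrite wD => /rowP rc; have := rc i0; rewrite !mxE D0 => c0.
by have := rc i1; rewrite !mxE -c0 => /eqP; rewrite (negPf (@Dneq0 i0 i1 _)).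
Qed.

(** Fredholm alternative: the all-ones row lies in the row space of [D] once it is annihilated by
    the cokernel. By symmetry the columns of the cokernel are transposed kernel vectors, and these
    have mass 0. *)
Lemma equilibrium_exists : exists v, v *m D = const_mx 1.
Proof.
suff /submxP[v ->] : ((const_mx 1 : 'rV_n) <= D)%MS by exists v.
rewrite submxE; apply/eqP/rowP => j; rewrite !mxE.
rewrite -[RHS](@kernel_total (row j (cokermx D)^T)); last first.
  by rewrite -row_mul -[in X in _ *m X]Dsym -trmx_mul mulmx_coker trmx0 row0.
by apply: eq_bigr => i _; rewrite !mxE mul1r.
Qed.

(** If [w *m D] is constant equal to [c], evaluating [form v w] from both sides gives
    [c * total v = total w = 0], hence [c = 0]. *)
Lemma isotropic_kernel v w : v *m D = const_mx 1 -> total v != 0 ->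
  isotropic w <-> (w <= kermx D)%MS.
Proof.
move=> vD v0; split=> [/isotropicP[w0 [c wD]]|/sub_kermxP wD].
  apply/sub_kermxP; rewrite wD.
  have := form_const v wD; rewrite formC (form_const _ vD) w0 mulr0.
  by move=> /esym/eqP; rewrite mulf_eq0 (negPf v0) orbF => /eqP->.
by apply/isotropicP; split; [exact: kernel_total|exists 0].
Qed.

(** If [w *m D] is constant equal to [c], then [w - c *: v] is in the kernel. Conversely [v] is
    itself isotropic, because its mass is 0. *)
Lemma isotropic_kernel_add v w : v *m D = const_mx 1 -> total v = 0 ->
  isotropic w <-> (w <= kermx D + v)%MS.
Proof.
move=> vD v0; split=> [/isotropicP[w0 [c wD]]|/sub_addsmxP[[a b]/= ->]].
  rewrite -(subrK (c *: v) w) addmx_sub_adds ?scalemx_sub//.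
  apply/sub_kermxP; rewrite mulmxBl wD -scalemxAl vD.
  by apply/rowP => i; rewrite !mxE mulr1 subrr.
rewrite (mx11_scalar b) mul_scalar_mx; apply/isotropicP; split.
  rewrite totalD totalZ v0 mulr0 addr0; apply: kernel_total.
  by rewrite -mulmxA mulmx_ker mulmx0.
exists (b 0 0); rewrite mulmxDl -mulmxA mulmx_ker mulmx0 add0r -scalemxAl vD.
by apply/rowP => i; rewrite !mxE mulr1.
Qed.

Lemma rank_kernel_add v : v *m D = const_mx 1 ->
  \rank (kermx D + v)%MS = (n - \rank D).+1.
Proof.
move=> vD.
have c1 : const_mx 1 != 0 :> 'rV[F]_n.
  apply/eqP => /rowP/(_ (Ordinal n_gt1)); rewrite !mxE => /eqP.
  by rewrite oner_eq0.
have v_neq0 : v != 0.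
  by apply: contraNneq c1 => v0; rewrite -vD v0 mul0mx.
rewrite mxrank_disjoint_sum.
  by rewrite mxrank_ker rank_rV v_neq0 addn1.
apply/eqP; rewrite -submx0; apply/rV_subP => w; rewrite sub_capmx.
move=> /andP[/sub_kermxP wD /sub_rVP[a wE]]; move: wD.
rewrite wE -scalemxAl vD => /eqP; rewrite scaler_eq0 (negPf c1) orbF.
by move=> /eqP->; rewrite scale0r sub0mx.
Qed.

(** Presents the coordinate space of [A] as the row space of the identity restricted to the rows in
    [A], so that rank arguments apply to it. *)
Lemma supported_rowsub A v :
  supported A v <-> (v <= rowsub (enum_val (A := A)) 1%:M)%MS.
Proof.
split=> [sv|/submxP[u ->] i iA].
  apply/submxP; exists (\row_k v 0 (enum_val k)); apply/rowP => i.
  rewrite !mxE; have [iA|iA] := boolP (i \in A); last first.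
    rewrite sv// big1// => k _; rewrite !mxE.
    case: eqP => [ki|_]; last by rewrite mulr0.
    by rewrite -ki enum_valP in iA.
  rewrite (bigD1 (enum_rank_in iA i))//= !mxE enum_rankK_in// eqxx mulr1.
  rewrite big1 ?addr0// => k kr; rewrite !mxE; case: eqP => [ki|_].
    by move: kr; rewrite -[k in k != _](enum_valK_in iA) ki eqxx.
  by rewrite mulr0.
rewrite mxE big1// => k _; rewrite !mxE; case: eqP => [ki|_].
  by rewrite -ki enum_valP in iA.
by rewrite mulr0.
Qed.

(** The rows are distinct unit vectors, so the transpose is a right inverse. *)
Lemma rank_rowsub A :
  \rank (rowsub (enum_val (A := A)) 1%:M : 'M[F]_(_, n)) = #|A|.
Proof.
apply/eqP/row_freeP; exists (rowsub (enum_val (A := A)) 1%:M)^T.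
apply/matrixP => i j; rewrite !mxE (bigD1 (enum_val j))//= !mxE eqxx mulr1.
rewrite (inj_eq enum_val_inj) big1 ?addr0// => k kj.
by rewrite !mxE (eq_sym (enum_val j)) (negPf kj) mulr0.
Qed.

(** Strictness makes the coordinate space of [A] and the row space of [K] independent, so their
    ranks add up. Maximality shows that every unit vector lies in their sum. *)
Lemma card_maximal_strict m A (K : 'M[F]_(m, n)) :
  (forall v, isotropic v <-> (v <= K)%MS) ->
  strict A -> (forall B, A \proper B -> ~ strict B) ->
  (#|A| + \rank K = n)%N.
Proof.
move=> KE sA maxA; rewrite -rank_rowsub -mxrank_disjoint_sum; last first.
  apply/eqP; rewrite -submx0; apply/rV_subP => w; rewrite sub_capmx.
  move=> /andP[/supported_rowsub wA /KE wK].
  by rewrite (sA _ wA wK) sub0mx.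
apply/eqP; change (row_full (rowsub (enum_val (A := A)) 1%:M + K)%MS).
rewrite -sub1mx; apply/row_subP => i; rewrite row1.
have [iA|iA] := boolP (i \in A).
  apply: submx_trans (addsmxSl _ _); apply/supported_rowsub => j jA.
  rewrite mxE eqxx/=; case: eqP => // ji.
  by rewrite ji iA in jA.
(* If the unit vector at [i] were outside the sum, [i |: A] would be strict: an isotropic [v] on it
   with [v 0 i != 0] would, after rescaling, differ from that unit vector by a vector supported on
   [A]. So [v 0 i = 0], and strictness of [A] applies. *)
apply: contraT => niU; exfalso.
have /maxA : A \proper i |: A by rewrite properUr// finset.sub1set.
apply=> v vS iv; apply: sA => // j jA.
have [ji|ji] := eqVneq j i; last by apply: vS; rewrite !inE negb_or ji.
rewrite ji; apply/eqP; apply: contraNT niU => vi.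
rewrite -[delta_mx 0 i](subrK ((v 0 i)^-1 *: v)) addmx_sub_adds//.
  apply/supported_rowsub => k kA; rewrite !mxE eqxx/=.
  have [ki|ki] := eqVneq k i; first by rewrite ki mulVf// subrr.
  by rewrite mulr0n (vS k) ?mulr0 ?subrr// !inE negb_or ki.
by rewrite scalemx_sub//; apply/KE.
Qed.

End negative_type.

(** * Signed measures and their integrals on a finite metric space *)

Section finite_support.
Context (R : realType) (T : pointedMetricType R) (I : finType) (A : {set I}).
Variable f : I -> T.
Hypothesis finj : {in A &, injective f}.
Hypothesis fsurj : forall t, exists2 i, i \in A & f i = t.

Lemma finite_space (S : set T) : finite_set S.
Proof.
apply: (@sub_finite_set _ _ (f @` [set` A])).
  by move=> t _; have [i iA <-] := fsurj t; exists i.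
exact/finite_image/finite_finset.
Qed.

Lemma measurable_borel (S : set (borel T)) : measurable S.
Proof.
rewrite -(setCK S); apply: measurableC; apply: sub_sigma_algebra.
have : closed (S : set T).
  apply: (iffLR accessible_finite_set_closed); last exact: finite_space.
  exact/hausdorff_accessible/metric_hausdorff.
by rewrite -openC.
Qed.

Lemma Rintegral_finite (m : {measure set (borel T) -> \bar R})
    (g : borel T -> R) :
  (forall S, measurable S -> m S \is a fin_num) ->
  \int[m]_x g x = \sum_(i in A) g (f i) * fine (m [set f i : borel T]).
Proof.
move=> mfin.
have TE : \big[setU/set0]_(i <- enum A) [set f i : borel T] = setT.
  apply/seteqP; split=> // t _; have [i iA <-] := fsurj t.
  by rewrite -bigcup_seq; exists i => //=; rewrite mem_enum.
rewrite -TE /Rintegral integral_bigsetU_EFin//.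
- rewrite (eq_bigr
    (fun i => (g (f i))%:E * m [set f i : borel T])%E); last first.
    move=> i _; rewrite -integral_cst; last exact: measurable_borel.
    by apply: eq_integral => t; rewrite inE => ->.
  rewrite -big_enum/= -sum_fine => [|i _]; last first.
    by rewrite fin_numM// mfin//; exact: measurable_borel.
  by apply: eq_bigr => i _; rewrite fineM// mfin//; exact: measurable_borel.
- by move=> i; exact: measurable_borel.
- exact: enum_uniq.
- move=> i j /=; rewrite !mem_enum => iA jA [t [/= ->]].
  exact: finj.
- by move=> ? S ?; exact: measurable_borel.
Qed.

Implicit Type mu : signed_measure T.

Definition weight mu i : R := fine (mu [set f i : borel T]).

(** The two Jordan parts recombine to [mu] at each point, which removes the chosen Hahn
    decomposition from the formula. *)
Lemma signed_integralE mu (g : borel T -> R) :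
  signed_integral mu g = \sum_(i in A) g (f i) * weight mu i.
Proof.
rewrite /signed_integral !Rintegral_finite;
  [|by move=> *; exact: fin_num_measure..].
rewrite -sumrB; apply: eq_bigr => i _; rewrite -mulrBr; congr (_ * _).
rewrite /weight (jordan_decomp (hahn_posneg mu)); last exact: measurable_borel.
rewrite /cadd/= cscaleN1 fineD ?fineN//.
  by apply: fin_num_measure; exact: measurable_borel.
by rewrite fin_numN; apply: fin_num_measure; exact: measurable_borel.
Qed.

Lemma charge_finite mu (S : set (borel T)) :
  mu S = (\sum_(i in A | f i \in S) weight mu i)%:E.
Proof.
have mS := measurable_borel S.
have muS : mu S \is a fin_num by exact: fin_num_measure.
rewrite -(fineK muS); congr EFin.
(* Integrating an indicator reduces the claim to the formula for integrals. *)
transitivity (signed_integral mu \1_S).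
  rewrite /signed_integral /Rintegral !integral_indic// !setIT.
  rewrite (jordan_decomp (hahn_posneg mu) mS).
  rewrite /cadd/= cscaleN1 fineD ?fineN//.
    by apply: fin_num_measure; exact: measurable_borel.
  by rewrite fin_numN; apply: fin_num_measure; exact: measurable_borel.
rewrite signed_integralE big_mkcondr; apply: eq_bigr => i _.
by rewrite indicE; case: ifP => _; rewrite ?mul1r ?mul0r.
Qed.

Lemma energyE mu : energy mu =
  \sum_(i in A) \sum_(j in A) weight mu j * weight mu i * mdist (f j) (f i).
Proof.
rewrite /energy signed_integralE; apply: eq_bigr => i _.
rewrite signed_integralE mulr_suml; apply: eq_bigr => j _.
by rewrite -mulrA mulrC.
Qed.

Lemma mass_finite mu : mu setT = (\sum_(i in A) weight mu i)%:E.
Proof.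
rewrite charge_finite; congr EFin.
by apply: eq_bigl => i; rewrite in_setT andbT.
Qed.

Lemma charge_of_weight (v : I -> R) :
  exists mu, {in A, forall i, weight mu i = v i}.
Proof.
(* A combination of Dirac masses, with its value prescribed on every set so that it can be built by
   induction on the list of points. *)
suff [mu muE] : exists mu : signed_measure T, forall S,
    mu S = (\sum_(i <- enum A) v i * \1_S (f i))%:E.
  exists mu => i iA; rewrite /weight muE/=.
  rewrite (bigD1_seq i) ?mem_enum ?enum_uniq//= indicE mem_set// mulr1.
  rewrite big_seq_cond big1 ?addr0// => j /andP[jA ji].
  rewrite indicE memNset ?mulr0//= => fji.
  by move: ji; rewrite (finj _ _ fji) ?eqxx// -mem_enum.
elim: (enum A) => [|i s [mu muE]].
  by exists (@czero _ (borel T) R) => S; rewrite big_nil.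
exists (cadd (cscale (v i)
  (charge_of_finite_measure (\d_(f i : borel T)))) mu) => S.
by rewrite big_cons EFinD -muE EFinM.
Qed.

End finite_support.

(** * Dictionary between signed measures and row vectors *)

Section finite_metric_form.
Context (R : realType) (n : nat) (D : 'M[R]_n) (A : {set 'I_n}).
Context (T : pointedMetricType R).
Variable f : 'I_n -> T.
Hypothesis finj : {in A &, injective f}.
Hypothesis fsurj : forall t, exists2 i, i \in A & f i = t.
Hypothesis fD : {in A &, forall i j, mdist (f i) (f j) = D i j}.
Implicit Types (mu : signed_measure T) (v : 'rV[R]_n).

(** Extension by zero off [A] puts the measures of all subspaces in the same vector space, with a
    single matrix [D]. *)
Definition weight_row mu : 'rV[R]_n :=
  \row_i (if i \in A then weight f mu i else 0).

Lemma supported_weight_row mu : supported A (weight_row mu).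
Proof. by move=> i /negPf iA; rewrite mxE iA. Qed.

Lemma weight_row_surj v : supported A v -> exists mu, weight_row mu = v.
Proof.
move=> vA; have [mu muE] := charge_of_weight finj (fun i => v 0 i).
exists mu; apply/rowP => i; rewrite mxE.
by case: ifPn => [/muE//|/vA].
Qed.

Lemma mass_total mu : mu setT = (total (weight_row mu))%:E.
Proof.
rewrite (mass_finite finj fsurj) /total big_mkcond; congr EFin.
by apply: eq_bigr => i _; rewrite mxE.
Qed.

Lemma energy_form mu : energy mu = form D (weight_row mu) (weight_row mu).
Proof.
rewrite (energyE finj fsurj) formE big_mkcond; apply: eq_bigr => i _.
have [iA|iA] := boolP (i \in A); last first.
  by rewrite big1// => j _; rewrite !mxE (negPf iA) mulr0 mul0r.
rewrite big_mkcond; apply: eq_bigr => j _; rewrite !mxE iA.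
by case: ifP => jA; rewrite ?mul0r// fD.
Qed.

Lemma quasihypermetric_form : quasihypermetric T <->
  forall v, supported A v -> total v = 0 -> form D v v <= 0.
Proof.
split=> [qT v vA v0|qD mu].
  have [mu muv] := weight_row_surj vA; rewrite -muv -energy_form.
  by apply: qT; rewrite /mass0/= mass_total muv v0.
rewrite /mass0/= mass_total => -[mu0]; rewrite energy_form.
by apply: qD => //; exact: supported_weight_row.
Qed.

Lemma strictly_quasihypermetric_form :
  strictly_quasihypermetric T <-> quasihypermetric T /\ strict D A.
Proof.
split=> -[qT sT]; split=> //.
  move=> v vA [v0 vv0]; have [mu muv] := weight_row_surj vA.
  apply/rowP => i; rewrite -muv !mxE; case: ifP => // iA.
  rewrite /weight sT ?energy_form ?muv//.
    by rewrite /mass0/= mass_total muv v0.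
  exact: measurable_borel fsurj _.
move=> mu; rewrite /mass0/= mass_total energy_form => -[mu0] emu S mS.
have /rowP mu_eq0 : weight_row mu = 0.
  by apply: sT => //; exact: supported_weight_row.
rewrite (charge_finite finj fsurj) big1// => i /andP[iA _].
by have := mu_eq0 i; rewrite !mxE iA.
Qed.

End finite_metric_form.

(** * Subspaces of X as sets of indices *)

Section subspace.
Context (R : realType) (X : pointedMetricType R) (n : nat) (x : 'I_n -> X).
Hypothesis xbij : bijective x.
Hypothesis qX : quasihypermetric X.

Let D := distance_matrix x.

Let xinj : {in [set: 'I_n]%SET &, injective x}.
Proof. by move=> i j _ _; exact: bij_inj. Qed.

Let xsurj t : exists2 i, i \in [set: 'I_n]%SET & x i = t.
Proof. by have [y yK xK] := xbij; exists (y t) => //; rewrite inE. Qed.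

Let xD : {in [set: 'I_n]%SET &, forall i j, mdist (x i) (x j) = D i j}.
Proof. by move=> i j _ _; rewrite mxE. Qed.

Let supportedT v : supported (F := R) [set: 'I_n]%SET v.
Proof. by move=> i; rewrite inE. Qed.

Lemma distance_form_nsd v : total v = 0 -> form D v v <= 0.
Proof.
exact: (iffLR (quasihypermetric_form xinj xsurj xD)).
Qed.

Lemma strict_subspaceP (A : {set 'I_n}) (Y : set X) :
  (forall i, (i \in A) = (x i \in Y)) -> Y !=set0 ->
  strictly_quasihypermetric_subspace Y <-> strict D A.
Proof.
move=> AY Y0.
have H (y : Y) : strictly_quasihypermetric (subspace_at y) <-> strict D A.
  (* For [i] outside [A] this takes the default value [y]; injectivity and the distance formula are
     claimed on [A] only. *)
  pose f i : subspace_at y := insubd y (x i).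
  have valf i : i \in A -> val (f i : Y) = x i.
    by move=> iA; rewrite insubdK// -AY.
  have finj : {in A &, injective f}.
    move=> i j iA jA /(congr1 val); rewrite !valf//; exact: bij_inj.
  have fsurj (t : subspace_at y) : exists2 i, i \in A & f i = t.
    have [g gK xK] := xbij; exists (g (val (t : Y))).
      by rewrite AY xK; exact: valP.
    by apply: val_inj; rewrite valf ?xK// AY xK; exact: valP.
  have fD : {in A &, forall i j, mdist (f i) (f j) = D i j}.
    move=> i j iA jA; rewrite mxE -[x i in RHS]valf// -[x j in RHS]valf//.
  rewrite (strictly_quasihypermetric_form finj fsurj fD); split=> [[]//|sA].
  (* The subspace inherits the inequality, since its vectors are among those of the whole space. *)
  split=> //; apply/(quasihypermetric_form finj fsurj fD) => v _.
  exact: distance_form_nsd.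
split=> [[y /H]//|sA]; have [y Yy] := Y0.
by exists (SigSub (mem_set Yy)); apply/H.
Qed.

Lemma card_fset_set_preimage (A : {set 'I_n}) (Y : set X) :
  (forall i, (i \in A) = (x i \in Y)) -> #|` fset_set Y| = #|A|.
Proof.
move=> AY; have finY : finite_set Y := finite_space xsurj Y.
rewrite cardE -(size_map x); apply: perm_size; apply: uniq_perm => //.
  by rewrite map_inj_uniq ?enum_uniq//; exact: bij_inj.
move=> t; rewrite in_fset_set//; have [i _ <-] := xsurj t.
by rewrite mem_map ?mem_enum ?AY//; exact: bij_inj.
Qed.

Lemma maximal_strict_preimage (Y : set X) :
  maximal_strictly_quasihypermetric Y ->
  exists A : {set 'I_n}, [/\ #|` fset_set Y| = #|A|, strict D A &
    forall B : {set 'I_n}, A \proper B -> ~ strict D B].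
Proof.
move=> [Y0 _ sY maxY]; pose A := [set i | x i \in Y]%SET.
have AY i : (i \in A) = (x i \in Y) by rewrite inE.
exists A; split; first exact: card_fset_set_preimage.
  exact/(strict_subspaceP AY Y0).
move=> B /properP[AB [i iB iA]] sB; apply: maxY.
(* A larger strict index set gives a larger strict subspace, compact because it is finite. *)
exists (x @` [set` B]); split.
- exact/finite_compact/finite_space/xsurj.
- apply/(@strict_subspaceP B) => // [j|]; last by exists (x i), i.
  apply/idP/idP => [jB|/set_mem[k kB /(bij_inj xbij) <-//]].
  by apply/mem_set; exists j.
- split=> [t Yt|ZY].
    have [j _ jt] := xsurj t; exists j => //; apply: (fintype.subsetP AB).
    by rewrite AY jt; exact: mem_set.
  move: iA; rewrite AY => /negP; apply; apply/mem_set/ZY.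
  by exists i.
Qed.

Lemma energy_le_max v : total v = 1 -> ((form D v v)%:E <= max_energy X)%E.
Proof.
move=> v1; have [mu muv] := weight_row_surj xinj (@supportedT v).
apply: ereal_sup_ubound; exists mu.
  by rewrite /mass1/= (mass_total xinj xsurj) muv v1.
by rewrite (energy_form xinj xsurj xD) muv.
Qed.

Lemma max_energy_le M : (forall v, total v = 1 -> form D v v <= M) ->
  (max_energy X <= M%:E)%E.
Proof.
move=> vM; apply: ge_ereal_sup => _ [mu + <-].
rewrite /mass1/= (mass_total xinj xsurj) (energy_form xinj xsurj xD) lee_fin.
by move=> [/vM].
Qed.

End subspace.

(** * The two cases of the rank formula *)

Theorem theorem2p9 (R : realType) (X : pointedMetricType R) (n : nat)
    (x : 'I_n -> X) (Y : set X) :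
  (1 < n)%N -> bijective x ->
  quasihypermetric X ->
  maximal_strictly_quasihypermetric Y ->
  let r := \rank (distance_matrix x) in
  ((max_energy X < +oo)%E -> #|` fset_set Y| = r) /\
  (max_energy X = +oo%E -> #|` fset_set Y| = (r - 1)%N).
Proof.
move=> n_gt1 xbij qX maxY r.
have [A [-> sA maxA]] := maximal_strict_preimage xbij qX maxY.
pose D := distance_matrix x.
have Dsym : D^T = D by apply/matrixP => i j; rewrite !mxE metric_sym.
have D0 i : D i i = 0 by rewrite mxE mdistxx.
have Dneq0 i j : i != j -> D i j != 0.
  by rewrite mxE; apply: contra_neq => /mdist_positivity/(bij_inj xbij).
have nsd v : total v = 0 -> form D v v <= 0 by exact: distance_form_nsd.
have [v vD] := equilibrium_exists Dsym D0 Dneq0 n_gt1 nsd.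
have rn : (r <= n)%N by exact: rank_leq_row.
(* The mass of [v] decides whether the supremum is infinite; in each branch one of the two
   implications has a contradictory premise. *)
have [v0|v0] := eqVneq (total v) 0.
  have := card_maximal_strict
    (fun w => isotropic_kernel_add Dsym D0 Dneq0 n_gt1 nsd w vD v0) sA maxA.
  rewrite rank_kernel_add// -/r => cA; split=> [Mfin|_]; last by lia.
  pose i := Ordinal n_gt1.
  have M2t t : ((2 * t)%:E <= max_energy X)%E.
    rewrite -(form_deltaDZ Dsym t (D0 i) vD v0).
    apply: energy_le_max => //.
    by rewrite totalD totalZ total_delta v0 mulr0 addr0.
  have Mfn : max_energy X \is a fin_num.
    rewrite fin_numElt Mfin andbT; exact: lt_le_trans (ltNyr _) (M2t 0).
  (* With this [t] the energy [2 * t] exceeds the supposed finite supremum by 2. *)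
  have := M2t (fine (max_energy X) / 2 + 1).
  rewrite -[leRHS](fineK Mfn) lee_fin => M_le.
  by exfalso; clear -M_le; lra.
have := card_maximal_strict
  (fun w => isotropic_kernel Dsym D0 Dneq0 n_gt1 nsd w vD v0) sA maxA.
rewrite mxrank_ker -/r => cA; split=> [_|Moo]; first by lia.
(* The energy of the normalised [v] is a finite upper bound, so the supremum cannot be infinite. *)
have := max_energy_le xbij (fun w => form_le_normalized Dsym nsd vD v0).
by rewrite Moo leye_eq.
Qed.
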